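(* Let $(X,R,I)$ be a finite unital regular relation partition, let $(Y,Q,J)$ be a finite unital relation partition, and let $(f,\sigma)$ be a quotient morphism from $(X,R,I)$ to $(Y,Q,J)$. For $g\in\mathbb{C}^X$ define its pushout $f_*g\in\mathbb{C}^Y$ along $f$ by $$f_*g(y):=\sum_{x\in f^{-1}(y)}g(x).$$ If $g$ is a $(\#X,k,\lambda)$-equi-distributed function on $(X,R,I)$, then $f_*g$ is a $(\#Y,k,(\#X/\#Y)\lambda)$-equi-distributed function on $(Y,Q,J)$.
   Context: A relation partition $(X,R,I)$ consists of sets $X,I$ and a surjection $R:X\times X\to I$. A morphism $(X,R,I)\to(Y,Q,J)$ is a pair of functions $f:X\to Y$, $\sigma:I\to J$ with $Q(f(x),f(x'))=\sigma(R(x,x'))$ for all $x,x'\in X$; it is a quotient morphism if $f$ and $\sigma$ are surjective. $(X,R,I)$ is regular if for every $i\in I$ there is an integer $k_i$ such that for all $x\in X$, $\#\{x'\in X: R(x,x')=i\}=k_i=\#\{x'\in X: R(x',x)=i\}$. It is unital if there is $i_0\in I$ (necessarily unique, called the unit) with $R^{-1}(\{i_0\})=\{(x,x):x\in X\}$. For $i\in I$, write $R^{-1}(i)=R^{-1}(\{i\})$, and let $A_i$ be the adjacency matrix: $A_i(x,x')=1$ if $R(x,x')=i$, and $0$ otherwise. For $g\in\mathbb{C}^X$, $(A_ig)(x')=\sum_{x\in X}A_i(x,x')g(x)$, and $(g,g')=\sum_{x\in X}g(x)\overline{g'(x)}$. For $X$ finite with $v=\#X$ and $(X,R,I)$ unital,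 the $i$-th inner distribution of $g$ is $\lambda_i:=v\cdot (A_ig,g)/\#R^{-1}(i)$. The function $g$ is equi-distributed if $\lambda_i$ is independent of $i\in I\setminus\{i_0\}$; it is $(v,k,\lambda)$-equi-distributed if $v=\#X$, $k=\sum_{x\in X}g(x)$, and $\lambda_i=\lambda$ for all $i\neq i_0$. *)

(* Defs.v *)
From HB Require Import structures.
From mathcomp Require Import all_boot all_order all_algebra.
From mathcomp Require Import reals complex.

Set Implicit Arguments.
Unset Strict Implicit.
Unset Printing Implicit Defensive.

Import Order.TTheory GRing.Theory Num.Theory.
Local Open Scope ring_scope.

(* A finite relation partition (X, r, I). Surjectivity of r onto I forces I to
   be finite as soon as X is, so I is taken to be a finType as well. *)
Record relpart (X I : finType) := RelPart {
  rel_of :> X -> X -> I;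
  rel_of_surj : forall i : I, exists x x' : X, rel_of x x' = i
}.

Section RelPart.
Variables X I : finType.
Implicit Types r : relpart X I.

Definition relset r (i : I) : {set X * X} := [set p | r p.1 p.2 == i].

Definition regular r : Prop :=
  forall i : I, exists k : nat, forall x : X,
    #|[set x' | r x x' == i]| = k /\ #|[set x' | r x' x == i]| = k.

Definition is_unit r (i : I) : Prop := relset r i = [set (x, x) | x : X].

Definition unital r : Prop := exists i0 : I, is_unit r i0.

End RelPart.

Definition is_morphism (X I Y J : finType) (r : relpart X I) (q : relpart Y J)
    (f : X -> Y) (sigma : I -> J) : Prop :=
  forall x x' : X, q (f x) (f x') = sigma (r x x').

Definition is_quotient_morphism (X I Y J : finType)
    (r : relpart X I) (q : relpart Y J) (f : X -> Y) (sigma : I -> J) : Prop :=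
  [/\ is_morphism r q f sigma,
      forall y : Y, exists x : X, f x = y
    & forall j : J, exists i : I, sigma i = j].

Section InnerDistribution.
Variables (R : realType) (X I : finType).
Implicit Types (r : relpart X I) (g : {ffun X -> R[i]}).

Definition adjacency r (i : I) (x x' : X) : R[i] := (r x x' == i)%:R.

(* The sum is over the first index of the adjacency matrix. *)
Definition adj_app r (i : I) g : {ffun X -> R[i]} :=
  [ffun x' => \sum_(x : X) adjacency r i x x' * g x].

Definition inner g g' : R[i] := \sum_(x : X) g x * (g' x)^*.

Definition inner_distribution r g (i : I) : R[i] :=
  #|X|%:R * inner (adj_app r i g) g / #|relset r i|%:R.

Definition equidistributed r (v : nat) (k lambda : R[i]) g : Prop :=
  [/\ v = #|X|, k = \sum_(x : X) g x
    & exists2 i0 : I, is_unit r i0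
        & forall i : I, i != i0 -> inner_distribution r g i = lambda].

End InnerDistribution.

Definition pushout (R : realType) (X Y : finType) (f : X -> Y)
    (g : {ffun X -> R[i]}) : {ffun Y -> R[i]} :=
  [ffun y => \sum_(x : X | f x == y) g x].

(* Main.v *)
Require Import Defs.
From HB Require Import structures.
From mathcomp Require Import all_boot all_order all_algebra.
From mathcomp Require Import reals complex.
From mathcomp Require Import ring.

Set Implicit Arguments.
Unset Strict Implicit.
Unset Printing Implicit Defensive.

Import Order.TTheory GRing.Theory Num.Theory.
Local Open Scope ring_scope.

(** For [j] in [J], grouping the pairs [(x, x')] by the fibres of [f] shows that
    [(A_j f_*g, f_*g)] is the sum of [g x * (g x')^*] over all pairs with
    [q (f x) (f x') = j], hence the sum of [(A_i g, g)] over the [i] with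
    [sigma i = j] ([inner_pushout]).  If [j] is not the unit of [q], no such [i]
    is the unit of [r], because [sigma] sends unit to unit; so each
    [(A_i g, g)] equals [lambda / #|X|] times the size of [R^-1(i)], and the sum
    is [lambda / #|X|] times the number of pairs mapped into [Q^-1(j)] by
    [f * f].

    To count these pairs, note that the fibre of [f] through [x] consists of the
    [x'] such that [sigma (r x x')] is the unit of [q], so regularity gives all
    the fibres the same size [m] ([card_fiber_const]).  Hence [#|X| = m * #|Y|],
    and the number of pairs is [m ^ 2] times the size of [Q^-1(j)]
    ([sum_card_relset]).  The inner distribution of [f_*g] at [j] is therefore
    [#|Y| * lambda * m ^ 2 / #|X| = (#|X| / #|Y|) * lambda]. *)

Lemma is_unitP (X I : finType) (r : relpart X I) (i0 : I) (x x' : X) :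
  is_unit r i0 -> (r x x' == i0) = (x == x').
Proof.
move=> /setP /(_ (x, x')); rewrite inE /= => ->.
by apply/imsetP/eqP => [[z _ [-> ->]] // | ->]; exists x'.
Qed.

Lemma card_relset_gt0 (X I : finType) (r : relpart X I) (i : I) :
  (0 < #|relset r i|)%N.
Proof.
have [x [x' rxx']] := rel_of_surj r i.
by apply/card_gt0P; exists (x, x'); rewrite inE /= rxx'.
Qed.

Lemma morphism_unit (X I Y J : finType) (r : relpart X I) (q : relpart Y J)
    (f : X -> Y) (sigma : I -> J) (i0 : I) (j0 : J) :
  is_morphism r q f sigma -> is_unit r i0 -> is_unit q j0 -> sigma i0 = j0.
Proof.
move=> fM i0U j0U; have [x [x' rxx']] := rel_of_surj r i0.
have xx' : x = x' by apply/eqP; rewrite -(is_unitP _ _ i0U) rxx'.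
by rewrite -rxx' -fM xx'; apply/eqP; rewrite (is_unitP _ _ j0U).
Qed.

(** If [j0] is the unit of [q], the fibre of [f] through [x] is the disjoint
    union, over the [i] with [sigma i = j0], of the sets of [x'] with
    [r x x' = i], whose sizes do not depend on [x]. *)
Lemma card_fiber_const (X I Y J : finType) (r : relpart X I) (q : relpart Y J)
    (f : X -> Y) (sigma : I -> J) :
  regular r -> unital q -> is_quotient_morphism r q f sigma ->
  exists m : nat, forall y : Y, #|[set x | f x == y]| = m.
Proof.
move=> rR [j0 j0U] [fM fS _].
have fiberE x :
    #|[set x' | f x' == f x]| =
    (\sum_(i | sigma i == j0) #|[set x' | r x x' == i]|)%N.
  transitivity (\sum_(x' | sigma (r x x') == j0) 1)%N.
    rewrite -sum1_card; apply: eq_bigl => x'.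
    by rewrite inE -fM (is_unitP _ _ j0U) eq_sym.
  rewrite (partition_big (r x) (fun i => sigma i == j0)) //=.
  apply: eq_bigr => i /eqP si; rewrite -sum1_card; apply: eq_bigl => x'.
  by rewrite inE andb_idl // => /eqP ->; rewrite si.
case: (pickP (@predT X)) => [x0 _ | X0].
  exists #|[set x | f x == f x0]| => y; have [x <-] := fS y.
  rewrite !fiberE; apply: eq_bigr => i _.
  by have [k rk] := rR i; rewrite (rk x).1 (rk x0).1.
by exists 0%N => y; have [x _] := fS y; have := X0 x.
Qed.

Lemma card_dom_fiber_const (X Y : finType) (f : X -> Y) (m : nat) :
  (forall y, #|[set x | f x == y]| = m) -> #|X| = (#|Y| * m)%N.
Proof.
move=> fm; rewrite -sum1_card (partition_big f predT) //= -sum_nat_const.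
apply: eq_bigr => y _; rewrite -(fm y) -sum1_card.
by apply: eq_bigl => x; rewrite inE.
Qed.

(** Both sides count the pairs [(x, x')] with [q (f x) (f x') = j]. *)
Lemma sum_card_relset (X I Y J : finType) (r : relpart X I) (q : relpart Y J)
    (f : X -> Y) (sigma : I -> J) (m : nat) (j : J) :
  is_morphism r q f sigma -> (forall y, #|[set x | f x == y]| = m) ->
  (\sum_(i | sigma i == j) #|relset r i|)%N = (m * m * #|relset q j|)%N.
Proof.
move=> fM fm; transitivity (\sum_(p : X * X | q (f p.1) (f p.2) == j) 1)%N.
  rewrite (partition_big (fun p => r p.1 p.2) (fun i => sigma i == j)) /=;
    last by move=> p; rewrite fM.
  apply: eq_bigr => i /eqP si; rewrite -sum1_card; apply: eq_bigl => p.
  by rewrite inE fM andb_idl // => /eqP ->; rewrite si.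
rewrite (partition_big (fun p => (f p.1, f p.2)) (mem (relset q j))) /=;
  last by move=> p; rewrite inE.
rewrite mulnC -sum_nat_const; apply: eq_bigr => -[y y']; rewrite inE /= => qj.
rewrite -{1}(fm y) -(fm y') -cardsX -sum1_card; apply: eq_bigl => -[x x'].
by rewrite !inE /= xpair_eqE andb_idl // => /andP[/eqP -> /eqP ->].
Qed.

Lemma sum_pushout (R : realType) (X Y : finType) (f : X -> Y)
    (g : {ffun X -> R[i]}) :
  \sum_y pushout f g y = \sum_x g x.
Proof.
rewrite [RHS](partition_big f predT) //=.
by apply: eq_bigr => y _; rewrite ffunE.
Qed.

Lemma innerE (R : realType) (X I : finType) (r : relpart X I) (i : I)
    (g : {ffun X -> R[i]}) :
  inner (adj_app r i g) g =
  \sum_(p : X * X | r p.1 p.2 == i) g p.1 * (g p.2)^*.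
Proof.
rewrite [RHS]big_mkcond /= -(pair_bigA _ (fun x x' =>
  if r x x' == i then g x * (g x')^* else 0)) /= exchange_big /=.
apply: eq_bigr => x' _; rewrite ffunE mulr_suml; apply: eq_bigr => x _.
by rewrite /adjacency; case: eqP => _; rewrite ?mul1r ?mul0r.
Qed.

(** Both sides are the sum of [g x * (g x')^*] over the pairs [(x, x')] with
    [q (f x) (f x') = j], grouped by [(f x, f x')] on the left and by [r x x']
    on the right. *)
Lemma inner_pushout (R : realType) (X I Y J : finType) (r : relpart X I)
    (q : relpart Y J) (f : X -> Y) (sigma : I -> J) (j : J)
    (g : {ffun X -> R[i]}) :
  is_morphism r q f sigma ->
  inner (adj_app q j (pushout f g)) (pushout f g) =
  \sum_(i | sigma i == j) inner (adj_app r i g) g.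
Proof.
move=> fM; rewrite innerE.
transitivity (\sum_(p : X * X | q (f p.1) (f p.2) == j) g p.1 * (g p.2)^*).
  rewrite [RHS](partition_big (fun p => (f p.1, f p.2))
    (fun p => q p.1 p.2 == j)) //=.
  apply: eq_bigr => -[y y'] /= qj; rewrite !ffunE rmorph_sum big_distrlr /=.
  rewrite pair_big /=; apply: eq_bigl => -[x x'] /=.
  by rewrite xpair_eqE [RHS]andb_idl // => /andP[/eqP -> /eqP ->].
rewrite (partition_big (fun p => r p.1 p.2) (fun i => sigma i == j)) /=;
  last by move=> p; rewrite fM.
apply: eq_bigr => i /eqP si; rewrite innerE; apply: eq_bigl => p.
by rewrite fM andb_idl // => /eqP ->; rewrite si.
Qed.

Theorem theorem3p2 (R : realType) (X I Y J : finType)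
    (r : relpart X I) (q : relpart Y J) (f : X -> Y) (sigma : I -> J)
    (g : {ffun X -> R[i]}) (k lambda : R[i])
    (r_unital : unital r) (r_regular : regular r) (q_unital : unital q)
    (f_quot : is_quotient_morphism r q f sigma)
    (g_equi : equidistributed r #|X| k lambda g) :
  equidistributed q #|Y| k (#|X|%:R / #|Y|%:R * lambda) (pushout f g).
Proof.
have [fM fS _] := f_quot; have [_ -> [i0 i0U gl]] := g_equi.
have [m fm] := card_fiber_const r_regular q_unital f_quot.
have [j0 j0U] := q_unital.
split=> //; first by rewrite sum_pushout.
exists j0 => // j jj0.
have cX := card_dom_fiber_const fm.
have [x0 _] := rel_of_surj r i0.
have X0 : #|X|%:R != 0 :> R[i].
  by rewrite pnatr_eq0 -lt0n; apply/card_gt0P; exists x0.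
have Y0 : #|Y|%:R != 0 :> R[i].
  by rewrite pnatr_eq0 -lt0n; apply/card_gt0P; exists (f x0).
have m0 : m%:R != 0 :> R[i].
  by move: X0; rewrite cX natrM mulf_eq0 negb_or => /andP[].
have Q0 : #|relset q j|%:R != 0 :> R[i].
  by rewrite pnatr_eq0 -lt0n card_relset_gt0.
have innE i : sigma i == j ->
    inner (adj_app r i g) g = lambda / #|X|%:R * #|relset r i|%:R.
  move=> /eqP si; have ii0 : i != i0.
    by apply: contraNneq jj0 => ei; rewrite -si ei (morphism_unit fM i0U j0U).
  have R0 : #|relset r i|%:R != 0 :> R[i].
    by rewrite pnatr_eq0 -lt0n card_relset_gt0.
  by rewrite -(gl i ii0) /inner_distribution; field; rewrite X0 R0.
rewrite /inner_distribution (inner_pushout j g fM) (eq_bigr _ innE) -mulr_sumr.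
rewrite -natr_sum (sum_card_relset j fM fm) cX !natrM.
by field; rewrite Y0 m0 Q0.
Qed.
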